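(* Let $H=H_0+H_{imp}$ be a quantum impurity model with impurity size $m$, and write $H_0=\sum_{j=1}^n\epsilon_j b_j^\dagger b_j$ in terms of its canonical modes, with $0\le\epsilon_j\le 1$. Let $\omega>0$ be such that each $\epsilon_j$ is either $0$ or lies in $[\omega,1]$. Then there exists a normalized ground state $\psi$ of $H$ such that the following holds: letting $C$ be the Hermitian $n\times n$ matrix $C_{jk}=\langle\psi|b_j^\dagger b_k|\psi\rangle$ with eigenvalues $\sigma_1\ge\sigma_2\ge\dots\ge\sigma_n\ge 0$, one has for all $j$ $$\sigma_j\le c\exp\!\left[-\frac{j}{14m\log(2\omega^{-1})}\right],$$ where $c>0$ is a universal constant.
   Context: Let $\mathcal{H}_n$ be the Fock space of $n$ fermionic modes with operators $a_j^\dagger,a_j$. Majorana operators: $c_{2j-1}=a_j+a_j^\dagger$, $c_{2j}=-i(a_j-a_j^\dagger)$, satisfying $c_pc_q+c_qc_p=2\delta_{pq}I$. A quantum impurity model is $H=H_0+H_{imp}$ with $H_0=\frac{\|h\|_1}{4}I+\frac{i}{4}\sum_{p,q=1}^{2n}h_{pq}c_pc_q$, $h$ real antisymmetric with $\|h\|\le1$, and $H_{imp}=\sum_{x\in\{0,1\}^m,|x|\text{ even}}g_xc_1^{x_1}\cdots c_m^{x_m}$ an arbitrary Hermitian operator of this form ($m$ = impurity size). Canonical modes of $H_0$: if $u_1,\dots,u_n\in\mathbb{C}^{2n}$ are orthonormal eigenvectors of $h$ with $hu_j=i\epsilon_ju_j$, $\epsilon_j\ge 0$, then $b_j=\sum_{p}(u_j)_pc_p$;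 they satisfy $b_j^2=0$, $\{b_i,b_j^\dagger\}=\delta_{ij}I$ and $H_0=\sum_j\epsilon_jb_j^\dagger b_j$. A ground state of $H$ is an eigenvector with the smallest eigenvalue.
   Formalization: The formal theorem assumes ω ≤ 1: for 1 < ω < 2 all ε_j vanish and the bound tends to 0 as ω → 2 while σ_1 can equal 1. Canonical modes are also required to satisfy {b_j, b_k} = 0 for all j, k, and the impurity size satisfies 1 ≤ m ≤ 2n. *)

(* Defs.v *)
From HB Require Import structures.
From mathcomp Require Import all_boot all_order all_algebra.
From mathcomp Require Import complex.
From mathcomp Require Import reals.
From mathcomp.analysis Require Import sequences exp.
Set Implicit Arguments. Unset Strict Implicit. Unset Printing Implicit Defensive.
Import Order.TTheory GRing.Theory Num.Theory.
Local Open Scope ring_scope.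
Local Open Scope complex_scope.

Section Fermions.
Variable R : realType.
Local Notation C := R[i].

(* Dimension of the Fock space of n modes: 2^n (written so that square
   matrices of this size carry a ring structure). *)
Definition Fdim (n : nat) : nat := (2 ^ n).-1.+1.

(* Computational basis |x> of the Fock space, x in {0,..,2^n-1};
   the occupation of mode j (0-indexed) is the j-th binary digit of x. *)
Definition occ (i j : nat) : bool := odd (i %/ 2 ^ j)%N.

Definition iC : C := Complex 0 1.

Definition adj (p q : nat) (A : 'M[C]_(p, q)) : 'M[C]_(q, p) :=
  trmx (map_mx (fun z : C => Num.conj z) A).

(* Annihilation operator a_j (Jordan-Wigner):
   a_j |x> = (-1)^(x_0+...+x_{j-1}) |x - e_j> if x_j = 1, and 0 otherwise. *)
Definition ann (n : nat) (j : 'I_n) : 'M[C]_(Fdim n) :=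
  \matrix_(y, x) (if occ x j && (val y == (val x - 2 ^ j)%N)
                  then (-1) ^+ (\sum_(k < j) occ x k)%N else 0).

Definition cre (n : nat) (j : 'I_n) : 'M[C]_(Fdim n) := adj (ann j).

(* Majorana operators, 0-indexed: for p in {0,..,2n-1} with j = p/2,
   c_p = a_j + a_j^dagger if p is even (the paper's c_{2j-1}),
   c_p = -i (a_j - a_j^dagger) if p is odd (the paper's c_{2j}). *)
Definition maj (n : nat) (p : 'I_(2 * n)) : 'M[C]_(Fdim n) :=
  match ltnP (p %/ 2) n with
  | LtnNotGeq H =>
      let j := Ordinal H in
      if odd p then - iC *: (ann j - cre j) else ann j + cre j
  | _ => 0
  end.

Definition spectrum (k : nat) (A : 'M[C]_k) (s : seq C) : Prop :=
  char_poly A = \prod_(z <- s) ('X - z%:P).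

(* Trace norm ||h||_1 of a real matrix: the sum of its singular values,
   i.e. of the square roots of the eigenvalues of h^T h. *)
Definition trace_norm (k : nat) (h : 'M[R]_k) : R :=
  \sum_(z <- sval (closed_field_poly_normal (char_poly (map_mx (fun r : R => r%:C) (trmx h *m h)))))
     complex.Re (sqrtC z).

Definition cplx (p q : nat) (A : 'M[R]_(p, q)) : 'M[C]_(p, q) :=
  map_mx (fun r : R => r%:C) A.

Definition H0 (n : nat) (h : 'M[R]_(2 * n)) : 'M[C]_(Fdim n) :=
  ((trace_norm h / 4)%:C)%:M
  + (iC / 4) *: \sum_(p < 2 * n) \sum_(q < 2 * n) ((h p q)%:C *: (maj p * maj q)).

Definition even_weight (m : nat) (x : {ffun 'I_m -> bool}) : bool :=
  ~~ odd #|[pred p | x p]|.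

(* c_1^{x_1} ... c_m^{x_m} (impurity Majoranas are the first m ones). *)
Definition maj_monomial (n m : nat) (hm : (m <= 2 * n)%N)
    (x : {ffun 'I_m -> bool}) : 'M[C]_(Fdim n) :=
  \prod_(p < m) (if x p then maj (widen_ord hm p) else 1).

Definition Himp (n m : nat) (hm : (m <= 2 * n)%N)
    (g : {ffun 'I_m -> bool} -> C) : 'M[C]_(Fdim n) :=
  \sum_(x : {ffun 'I_m -> bool} | even_weight x) g x *: maj_monomial hm x.

Definition is_hermitian (k : nat) (A : 'M[C]_k) : Prop := adj A = A.

Definition mode_op (n : nat) (u : 'cV[C]_(2 * n)) : 'M[C]_(Fdim n) :=
  \sum_(p < 2 * n) u p 0 *: maj p.

Definition expect (k : nat) (psi : 'cV[C]_k) (A : 'M[C]_k) : C :=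
  (adj psi *m A *m psi) 0 0.

Definition normalized_ground_state (k : nat) (H : 'M[C]_k) (psi : 'cV[C]_k) : Prop :=
  adj psi *m psi = 1%:M /\
  exists E : C, H *m psi = E *: psi /\
    forall (mu : C) (v : 'cV[C]_k), v != 0 -> H *m v = mu *: v -> E <= mu.

End Fermions.

(* Main.v *)
Require Import Defs.
From HB Require Import structures.
From mathcomp Require Import all_boot all_order all_algebra.
From mathcomp Require Import perm complex zify ring lra.
From mathcomp Require Import reals.
From mathcomp.analysis Require Import sequences exp.
Set Implicit Arguments. Unset Strict Implicit. Unset Printing Implicit Defensive.
Import Order.TTheory GRing.Theory Num.Theory.
Local Open Scope ring_scope.
Local Open Scope complex_scope.

(** Let psi be a ground state and A = H - E >= 0, and let X a be the state
obtained from psi by applying the mode with coefficients a in the basis b_j,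
so that the correlation matrix is X^* X. If a is orthogonal to the m impurity
sites, that is U a = 0, then X diag(eps) a = - A X a. Hence, if U diag(eps)^i a
vanishes for i below the number of shifts t > 0, X prod(t + eps) a equals
prod(t - A) X a, while X prod(t - eps) a equals prod(t + A) X a; the former is
no longer than the latter because A >= 0. On a subspace of small codimension,
X therefore contracts by the factor max |prod (t - eps) / (t + eps)|, as in
the alternating direction (ADI) method for Sylvester equations. Dyadic shifts
between omega and 1, each repeated s times, make this factor at most 3^-s, with
codimension m per shift. The zero modes, on which no shift acts, cost m more
conditions if psi is chosen in the kernel of all zero modes that do not touch
the impurity. The minimax principle turns these codimensions into the decay of
the eigenvalues. *)

(** * Adjoints and the squared norm *)
Section Adjoint.
Variable R : realType.
Local Notation C := R[i].
Implicit Types (p q r : nat).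

Lemma conjCM (x y : C) : (x * y)^*%R = x^*%R * y^*%R.
Proof. exact: rmorphM. Qed.

Lemma conj_realC (r : R) : (r%:C)^*%R = r%:C.
Proof. exact: conjc_real. Qed.

Lemma adjE p q (A : 'M[C]_(p, q)) i j : adj A i j = (A j i)^*%R.
Proof. by rewrite !mxE. Qed.

Lemma adj_map_trmx p q (A : 'M[C]_(p, q)) : adj A = map_mx Num.conj A^T.
Proof. by apply/matrixP => i j; rewrite !mxE. Qed.

Lemma adjK p q (A : 'M[C]_(p, q)) : adj (adj A) = A.
Proof. by apply/matrixP => i j; rewrite !adjE conjCK. Qed.

Lemma adjM p q r (A : 'M[C]_(p, q)) (B : 'M[C]_(q, r)) :
  adj (A *m B) = adj B *m adj A.
Proof. by rewrite /adj map_mxM trmx_mul. Qed.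

Lemma adjD p q (A B : 'M[C]_(p, q)) : adj (A + B) = adj A + adj B.
Proof. by apply/matrixP => i j; rewrite !(adjE, mxE) rmorphD. Qed.

Lemma adjN p q (A : 'M[C]_(p, q)) : adj (- A) = - adj A.
Proof. by apply/matrixP => i j; rewrite !(adjE, mxE) rmorphN. Qed.

Lemma adjB p q (A B : 'M[C]_(p, q)) : adj (A - B) = adj A - adj B.
Proof. by rewrite adjD adjN. Qed.

Lemma adjZ p q a (A : 'M[C]_(p, q)) : adj (a *: A) = a^*%R *: adj A.
Proof. by apply/matrixP => i j; rewrite !(adjE, mxE) rmorphM. Qed.

Lemma adj_scalar p (a : C) : adj (a%:M : 'M_p) = (a^*%R)%:M.
Proof.
by apply/matrixP => i j; rewrite !(adjE, mxE) rmorphMn eq_sym.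
Qed.

Lemma adj0 p q : adj (0 : 'M[C]_(p, q)) = 0.
Proof. by apply/matrixP => i j; rewrite !(adjE, mxE) conjC0. Qed.

Lemma adj_sum p q I (s : seq I) (P : pred I) (F : I -> 'M[C]_(p, q)) :
  adj (\sum_(i <- s | P i) F i) = \sum_(i <- s | P i) adj (F i).
Proof. by apply: (big_morph (@adj R p q)); [exact: adjD | exact: adj0]. Qed.

Definition dot p (v w : 'cV[C]_p) : C := (adj v *m w) 0 0.
(** Kept in [C], where [x <= y] also asserts that [y - x] is real; no real parts have to be
    taken. *)
Definition normsq p (v : 'cV[C]_p) : C := dot v v.

Lemma dotE p (v w : 'cV[C]_p) : dot v w = \sum_i (v i 0)^*%R * w i 0.
Proof. by rewrite /dot mxE; apply: eq_bigr => i _; rewrite adjE. Qed.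

Lemma normsqE p (v : 'cV[C]_p) : normsq v = \sum_i `|v i 0| ^+ 2.
Proof.
by rewrite /normsq dotE; apply: eq_bigr => i _; rewrite normCK mulrC.
Qed.

Lemma normsq_ge0 p (v : 'cV[C]_p) : 0 <= normsq v.
Proof. by rewrite normsqE sumr_ge0 // => i _; rewrite exprn_ge0. Qed.

Lemma normsq_eq0 p (v : 'cV[C]_p) : (normsq v == 0) = (v == 0).
Proof.
apply/eqP/eqP => [|->]; last by rewrite /normsq /dot mulmx0 mxE.
rewrite normsqE => /eqP; rewrite psumr_eq0; last by move=> i _; rewrite exprn_ge0.
move/allP => h0; apply/matrixP => i j; rewrite ord1 mxE; apply/eqP.
by have := h0 i (mem_index_enum i); rewrite expf_eq0 normr_eq0.
Qed.

Lemma normsq_gt0 p (v : 'cV[C]_p) : (0 < normsq v) = (v != 0).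
Proof. by rewrite lt_def normsq_eq0 normsq_ge0 andbT. Qed.

Lemma dotDl p (u v w : 'cV[C]_p) : dot (u + v) w = dot u w + dot v w.
Proof. by rewrite /dot adjD mulmxDl mxE. Qed.

Lemma dotDr p (u v w : 'cV[C]_p) : dot u (v + w) = dot u v + dot u w.
Proof. by rewrite /dot mulmxDr mxE. Qed.

Lemma dotZl p a (u v : 'cV[C]_p) : dot (a *: u) v = a^*%R * dot u v.
Proof. by rewrite /dot adjZ -scalemxAl mxE. Qed.

Lemma dotZr p a (u v : 'cV[C]_p) : dot u (a *: v) = a * dot u v.
Proof. by rewrite /dot -scalemxAr mxE. Qed.

Lemma dot_adjl p q (A : 'M[C]_(p, q)) u v : dot (A *m u) v = dot u (adj A *m v).
Proof. by rewrite /dot adjM mulmxA. Qed.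

Lemma normsqZ p a (u : 'cV[C]_p) : normsq (a *: u) = `|a| ^+ 2 * normsq u.
Proof. by rewrite /normsq dotZl dotZr mulrA normCK; congr (_ * _); rewrite mulrC. Qed.

Lemma normsq_isometry p q (P : 'M[C]_(p, q)) v :
  adj P *m P = 1%:M -> normsq (P *m v) = normsq v.
Proof. by move=> PP; rewrite /normsq dot_adjl mulmxA PP mul1mx. Qed.

Lemma dot_diag p (d : 'rV[C]_p) v :
  dot v (diag_mx d *m v) = \sum_i d 0 i * `|v i 0| ^+ 2.
Proof.
rewrite dotE; apply: eq_bigr => i _.
by rewrite mul_diag_mx !mxE normCK mulrCA mulrA mulrC; ring.
Qed.

End Adjoint.

(** * Hermitian matrices and the minimax principle *)
Section Spectral.
Variable R : realType.
Local Notation C := R[i].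

Lemma hermitian_diag p (A : 'M[C]_p) : is_hermitian A ->
  exists (P : 'M[C]_p) (d : 'rV[C]_p),
    [/\ adj P *m P = 1%:M, P *m adj P = 1%:M & A = adj P *m diag_mx d *m P].
Proof.
move=> hA; have nA : A \is normalmx.
  by apply/normalmxP; rewrite -adj_map_trmx hA.
have Pu := spectral_unitarymx A.
have := orthomx_spectralP nA; rewrite invmx_unitary // -adj_map_trmx => eA.
have /unitarymxP := Pu; rewrite -adj_map_trmx => PP.
by exists (spectralmx A), (spectral_diag A); split => //; apply: mulmx1C.
Qed.

Lemma char_poly_conj p (P Q D : 'M[C]_p) : Q *m P = 1%:M ->
  char_poly (P *m D *m Q) = char_poly D.
Proof.
move=> QP; have PQ := mulmx1C QP.
rewrite /char_poly /char_poly_mx !map_mxM.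
set f := map_mx _; have fPQ : f P *m f Q = 1%:M by rewrite -map_mxM PQ map_mx1.
have fQP : f Q *m f P = 1%:M by rewrite -map_mxM QP map_mx1.
transitivity (\det (f P *m ('X%:M - f D) *m f Q)).
  congr (\det _); rewrite mulmxBr mulmxBl; congr (_ - _).
  by rewrite mul_mx_scalar -scalemxAl fPQ scalemx1.
by rewrite !det_mulmx mulrAC -det_mulmx fPQ det1 mul1r.
Qed.

Lemma char_poly_diag p (d : 'rV[C]_p) :
  char_poly (diag_mx d) = \prod_(i < p) ('X - (d 0 i)%:P).
Proof.
rewrite char_poly_trig ?diag_mx_is_trig //.
by apply: eq_bigr => i _; rewrite mxE eqxx mulr1n.
Qed.

(** Two factorizations of the characteristic polynomial have the same roots up to a permutation;
    permuting the rows of the diagonalizing unitary puts the eigenvalues in the order of [s]. *)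
Lemma hermitian_diag_spectrum p (A : 'M[C]_p) (s : 'I_p -> C) :
  is_hermitian A -> spectrum A [seq s i | i <- enum 'I_p] ->
  exists P : 'M[C]_p,
    [/\ adj P *m P = 1%:M, P *m adj P = 1%:M
      & A = adj P *m diag_mx (\row_i s i) *m P].
Proof.
move=> /hermitian_diag[P [d [PP PP' ->]]]; rewrite /spectrum char_poly_conj //.
rewrite char_poly_diag => eq_prod.
have /tuple_permP[t /= et] : perm_eq [seq s i | i <- enum 'I_p] [tuple d 0 i | i < p].
  apply: prod_XsubC_eq; rewrite -eq_prod /= big_map big_enum /=.
  by apply: eq_bigr => i _.
have st i : s i = d 0 (t i).
  have := congr1 (nth 0 ^~ i) et.
  rewrite (nth_map i) ?size_enum_ord // nth_ord_enum.
  rewrite (nth_map i) ?size_enum_ord // nth_ord_enum.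
  by rewrite tnth_mktuple.
exists (perm_mx t *m P); rewrite adjM.
have -> : adj (perm_mx t : 'M[C]_p) = perm_mx t^-1.
  rewrite -tr_perm_mx; apply/matrixP => i j.
  by rewrite adjE !mxE conjC_nat.
have tt : perm_mx t^-1 *m perm_mx t = 1%:M :> 'M[C]_p.
  by rewrite -perm_mxM mulVg perm_mx1.
split.
- by rewrite mulmxA -[_ *m _ *m perm_mx t]mulmxA tt mulmx1.
- by rewrite mulmxA -[_ *m P *m _]mulmxA PP' mulmx1 -perm_mxM mulgV perm_mx1.
rewrite !mulmxA; congr (_ *m _); rewrite -!mulmxA; congr (_ *m _).
apply/matrixP => i j; rewrite mulmxA -row_permE -{2}[t]invgK -col_permE !mxE !st.
by rewrite permKV (inj_eq perm_inj).
Qed.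

Lemma kernel_vector p n (M : 'M[C]_(p, n)) : (p < n)%N ->
  exists2 w : 'cV[C]_n, w != 0 & M *m w = 0.
Proof.
move=> ltpn; have : kermx M^T != 0.
  rewrite -mxrank_eq0 mxrank_ker mxrank_tr -lt0n subn_gt0.
  exact: leq_ltn_trans (rank_leq_row _) ltpn.
case/rowV0Pn => v /sub_kermxP vM v0; exists v^T.
  by rewrite -(inj_eq trmx_inj) trmxK trmx0.
by apply: trmx_inj; rewrite trmx_mul trmxK trmx0.
Qed.

(** One half of Courant-Fischer: the span of the eigenvectors of the [j + 1] largest eigenvalues is
    too large to meet the kernel of [M], of codimension at most [k <= j], only in 0. On a common
    vector the Rayleigh quotient is at least [s j] and at most [b]. *)
Lemma minimax_bound n k q (X : 'M[C]_(q, n)) (M : 'M[C]_(k, n)) (s : 'I_n -> R)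
    (b : R) (j : 'I_n) :
  (forall i l : 'I_n, (i <= l)%N -> s l <= s i) ->
  spectrum (adj X *m X) [seq (s i)%:C | i <- enum 'I_n] ->
  (k <= j)%N ->
  (forall a, M *m a = 0 -> normsq (X *m a) <= b%:C * normsq a) ->
  s j <= b.
Proof.
have hXX : is_hermitian (adj X *m X) by rewrite /is_hermitian adjM adjK.
move=> s_mono /(hermitian_diag_spectrum hXX)[P [PP PP' eXX]] kj Xb.
(* In eigenbasis coordinates, [S] reads off the entries after the [j]-th, so its kernel is the span
   of the top eigenvectors. *)
pose S : 'M[C]_(n - j.+1, n) := \matrix_(i, l) (l == j.+1 + i :> nat)%N%:R.
have ltn : (k + (n - j.+1) < n)%N by have := ltn_ord j; lia.
have [w w0] := kernel_vector (col_mx (M *m adj P) S) ltn.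
rewrite mul_col_mx => /eqP; rewrite col_mx_eq0 => /andP[/eqP Mw /eqP Sw].
have wj (i : 'I_n) : (j < i)%N -> w i 0 = 0.
  move=> ji; have il : (i - j.+1 < n - j.+1)%N by have := ltn_ord i; lia.
  have := congr1 (fun A : 'cV_ _ => A (Ordinal il) 0) Sw; rewrite !mxE => <-.
  rewrite (bigD1 i) //= mxE /= subnKC // eqxx mul1r big1 ?addr0 // => l li.
  rewrite mxE /= subnKC //; case: eqP => [e|]; last by rewrite mul0r.
  by case/eqP: li; apply: val_inj.
have := Xb (adj P *m w); rewrite mulmxA => /(_ Mw).
rewrite (@normsq_isometry _ _ _ (adj P)) ?adjK // {1}/normsq dot_adjl mulmxA eXX.
rewrite dot_adjl adjK !mulmxA PP' mul1mx -(mulmxA _ P) PP' mulmx1 dot_diag => le_b.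
have : (s j)%:C * normsq w <= b%:C * normsq w.
  apply: le_trans le_b; rewrite normsqE mulr_sumr; apply: ler_sum => i _.
  rewrite mxE; have [ij|ji] := leqP i j; last by rewrite wj // normr0 expr0n !mulr0.
  by rewrite ler_wpM2r ?exprn_ge0 // lecR s_mono.
by rewrite ler_pM2r ?normsq_gt0 // lecR.
Qed.

End Spectral.

(** * Canonical anticommutation relations *)

(** Serves to present every Majorana operator as a permutation of the basis states with phases. *)
Definition flip (j x : nat) : nat := if occ x j then (x - 2 ^ j)%N else (x + 2 ^ j)%N.

Lemma occ_ge j x : occ x j -> (2 ^ j <= x)%N.
Proof. by rewrite /occ; case: leqP => // /divn_small ->. Qed.

Lemma occ_flip j k x : occ (flip j x) k = occ x k (+) (k == j).
Proof.
(* Isolate digit [j]: [x] is [(b + 2a) 2^j + r] with [r < 2^j], and flipping changes only [b]. *)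
pose b := occ x j; pose r := (x %% 2 ^ j)%N; pose a := (x %/ 2 ^ j)./2.
have rlt : (r < 2 ^ j)%N by rewrite ltn_mod expn_gt0.
have ex : x = ((b + a.*2) * 2 ^ j + r)%N.
  by rewrite /b /a /occ odd_double_half -divn_eq.
have ef : flip j x = ((~~ b + a.*2) * 2 ^ j + r)%N.
  by rewrite /flip -/b {1 2}ex; case: b {ex} => /=; lia.
rewrite ef /occ {1}ex; case: (ltngtP k j) => [kj|jk|->].
- rewrite addbF.
  have dv c : (2 ^ k %| c * 2 ^ j)%N by rewrite dvdn_mull // dvdn_exp2l // ltnW.
  rewrite !divnDl // !oddD; congr (_ (+) _).
  have -> : (2 ^ j = 2 ^ (j - k) * 2 ^ k)%N by rewrite -expnD subnK // ltnW.
  rewrite !mulnA !mulnK ?expn_gt0 // !oddM.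
  by rewrite oddX subn_eq0 leqNgt kj /= !andbF.
- have -> : (2 ^ k = 2 ^ j * (2 * 2 ^ (k - j.+1)))%N.
    by rewrite -expnS mulnC -expnD; congr (2 ^ _)%N; lia.
  rewrite addbF !(divnMA _ (2 ^ j)).
  rewrite !divnMDl ?expn_gt0 // (divn_small rlt) !addn0 !(divnMA _ 2).
  by case: b {ex ef} => /=; rewrite !divn2 ?add0n ?add1n /= ?uphalf_double ?doubleK.
rewrite !divnMDl ?expn_gt0 // (divn_small rlt) !addn0 !oddD !odd_double !addbF.
by case: b {ex ef}.
Qed.

Lemma flipK j : involutive (flip j).
Proof.
move=> x; rewrite {1}/flip occ_flip eqxx addbT /flip.
by case: (boolP (occ x j)) => [/occ_ge ?|_] /=; lia.
Qed.

Lemma occ_inj x y : occ x =1 occ y -> x = y.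
Proof.
have [n] := ubnP (x + y); elim: n x y => // n IHn x y ltn exy.
have e0 : odd x = odd y by have := exy 0%N; rewrite /occ !divn1.
have eh : x./2 = y./2.
  case: (posnP (x + y)) => [|xy]; first by case: x y {ltn exy e0} => [|x] [|y].
  apply: IHn => [|k]; first by lia.
  by have := exy k.+1; rewrite /occ expnS !divnMA !divn2.
by rewrite -(odd_double_half x) -(odd_double_half y) e0 eh.
Qed.

Lemma flipC j k x : flip j (flip k x) = flip k (flip j x).
Proof. by apply: occ_inj => l; rewrite !occ_flip addbAC. Qed.

Lemma flip_ltn n j x : (j < n)%N -> (x < 2 ^ n)%N -> (flip j x < 2 ^ n)%N.
Proof.
move=> jn xn; rewrite /flip; case: ifP => ox; first by rewrite (leq_ltn_trans (leq_subr _ _)).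
(* [2 ^ n] is an even multiple of [2 ^ j], and the quotient of [x] by [2 ^ j] is even here, so
   raising it by one stays below. *)
have en : (2 ^ n = 2 ^ (n - j.+1) * 2 * 2 ^ j)%N.
  by rewrite -mulnA -expnS -expnD; congr (2 ^ _)%N; lia.
move: xn; rewrite en -!ltn_divLR ?expn_gt0 // divnDr // divnn expn_gt0 addn1.
move: ox; rewrite /occ; lia.
Qed.

(** * Majorana operators in the Jordan-Wigner representation *)

Section Majorana.
Variable R : realType.
Local Notation C := R[i].

Lemma iC_sqr : iC R * iC R = -1.
Proof. by rewrite -expr2 sqr_i. Qed.

Lemma conj_iC : (iC R)^*%R = - iC R.
Proof. by apply/eqP; rewrite eq_complex /= oppr0 !eqxx. Qed.

Definition string_sign (j x : nat) : C := (-1) ^+ (\sum_(k < j) occ x k)%N.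

(** The phase in [c_p |x> = phase |flip (p / 2) x>]. *)
Definition maj_phase (p x : nat) : C :=
  string_sign (p %/ 2) x
  * (if odd p then iC R * (-1) ^+ occ x (p %/ 2) else 1).

Lemma string_sign_flip j k x :
  string_sign j (flip k x) = (-1) ^+ (k < j)%N * string_sign j x.
Proof.
rewrite /string_sign !expr_sum.
under eq_bigr => i _ do rewrite occ_flip signr_addb.
rewrite big_split /= mulrC; congr (_ * _).
have [kj|jk] := ltnP k j.
  rewrite (bigD1 (Ordinal kj)) //= eqxx big1 ?mulr1 // => i ik.
  by have -> : (i == k :> nat) = false by apply: negbTE.
rewrite big1 // => i _; case: eqP => // ik.
by have := ltn_ord i; rewrite ik ltnNge jk.
Qed.

Lemma maj_phase_flip p k x :
  maj_phase p (flip k x) =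
  (-1) ^+ ((k < p %/ 2)%N || (k == p %/ 2)%N && odd p) * maj_phase p x.
Proof.
rewrite /maj_phase string_sign_flip occ_flip (eq_sym _ k).
case: ltngtP => _; case: (odd p); rewrite ?addbF ?addbT /= -?mulrA ?mul1r //.
by case: (occ _ _); rewrite /= ?expr0 ?expr1; ring.
Qed.

Lemma Fdim_gt n (x : 'I_(Fdim n)) : (x < 2 ^ n)%N.
Proof. by have := ltn_ord x; rewrite {2}/Fdim prednK ?expn_gt0. Qed.

Lemma Fdim_ltn n x : (x < 2 ^ n)%N -> (x < Fdim n)%N.
Proof. by rewrite /Fdim prednK ?expn_gt0. Qed.

Lemma annE n (j : 'I_n) (y x : 'I_(Fdim n)) :
  ann R j y x = (occ x j && (y == flip j x :> nat)%N)%:R * string_sign j x.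
Proof.
rewrite mxE /flip; case: (occ x j) => /=; last by rewrite mul0r.
by rewrite /string_sign; case: eqP; rewrite ?mul1r ?mul0r.
Qed.

Lemma creE n (j : 'I_n) (y x : 'I_(Fdim n)) :
  cre R j y x = (~~ occ x j && (y == flip j x :> nat)%N)%:R * string_sign j x.
Proof.
rewrite /cre adjE annE conjCM conjC_nat.
have -> : (string_sign j y)^*%R = string_sign j y by exact: rmorph_sign.
rewrite -(can2_eq (flipK j) (flipK j)) (eq_sym (val y)).
have [<-|_] := eqVneq (flip j x) y; last by rewrite !andbF !mul0r.
by rewrite occ_flip eqxx addbT string_sign_flip ltnn mul1r.
Qed.

Lemma maj_half n (p : 'I_(2 * n)) : (p %/ 2 < n)%N.
Proof. by have := ltn_ord p; lia. Qed.

Lemma majE n (p : 'I_(2 * n)) (y x : 'I_(Fdim n)) :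
  maj R p y x = (y == flip (p %/ 2) x :> nat)%N%:R * maj_phase p x.
Proof.
rewrite /maj; case: ltnP => [jn|]; last by rewrite leqNgt maj_half.
rewrite /maj_phase; case: (odd p).
  rewrite 2!mxE annE mxE creE /=; case: (occ x _); case: (_ == _) => /=; ring.
by rewrite mxE annE creE /=; case: (occ x _); case: (_ == _) => /=; ring.
Qed.

Lemma majM n (p q : 'I_(2 * n)) (y x : 'I_(Fdim n)) :
  (maj R p * maj R q) y x =
  (y == flip (p %/ 2) (flip (q %/ 2) x) :> nat)%N%:R
  * (maj_phase p (flip (q %/ 2) x) * maj_phase q x).
Proof.
rewrite mxE.
have zlt := Fdim_ltn (flip_ltn (maj_half q) (Fdim_gt x)).
rewrite (bigD1 (Ordinal zlt)) //= big1 ?addr0 => [|z zx].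
  by rewrite !majE /= eqxx mul1r mulrA.
by rewrite (majE q) -[flip _ x]/(val (Ordinal zlt)) (inj_eq val_inj) (negbTE zx) mul0r mulr0.
Qed.

Lemma maj_phase_sqr p x : maj_phase p x * maj_phase p x = (-1) ^+ odd p.
Proof.
rewrite /maj_phase mulrACA -expr2 sqrr_sign mul1r; case: (odd p); last by rewrite mulr1.
by rewrite mulrACA iC_sqr -expr2 sqrr_sign mulr1.
Qed.

(** Both orders of the product toggle the same digits, so only the phases matter. For distinct [p]
    and [q], exactly one of the two flips reverses the phase of the other operator: the flip at the
    smaller mode or, within one mode, the flip seen by the odd index. *)
Lemma maj_car n (p q : 'I_(2 * n)) :
  maj R p * maj R q + maj R q * maj R p = ((p == q)%:R *+ 2)%:M.
Proof.
apply/matrixP => y x; rewrite mxE !majM flipC -mulrDr !maj_phase_flip [RHS]mxE.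
have [<-|pq] := eqVneq p q.
  rewrite flipK -[(_ == _ :> nat)]/(y == x) ltnn eqxx /= -mulrA maj_phase_sqr.
  by rewrite -expr2 sqrr_sign; case: (y == x) => /=; ring.
rewrite !mul0rn.
have cancel (a b : bool) : a = ~~ b ->
    (-1) ^+ a * maj_phase p x * maj_phase q x
    + (-1) ^+ b * maj_phase q x * maj_phase p x = 0 :> C.
  by move=> ->; case: b => /=; rewrite ?expr0 ?expr1; ring.
rewrite cancel ?mulr0 //; case: (ltngtP (p %/ 2) (q %/ 2)) => //= e.
have : odd p != odd q.
  apply: contraNneq pq => o; apply/eqP/val_inj.
  by rewrite /= -(odd_double_half p) -(odd_double_half q) o -!divn2 e.
by case: (odd p); case: (odd q).
Qed.

Lemma adj_maj n (p : 'I_(2 * n)) : adj (maj R p) = maj R p.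
Proof.
apply/matrixP => y x; rewrite adjE !majE conjCM conjC_nat.
rewrite -(can2_eq (flipK _) (flipK _)) (eq_sym (val y)).
have [<-|_] := eqVneq (flip (p %/ 2) x) y; last by rewrite !mul0r.
have conj_sign k : ((-1) ^+ k : C)^*%R = (-1) ^+ k by exact: rmorph_sign.
rewrite !mul1r maj_phase_flip ltnn eqxx orFb andTb /maj_phase.
case: (odd p); last by rewrite !mulr1 mul1r conj_sign.
by rewrite 3!conjCM !conj_sign conj_iC expr1 mulN1r mulNr mulrN opprK.
Qed.

End Majorana.

(** * Commutators of the Hamiltonian with the modes *)
Section Commutators.
Variable R : realType.
Local Notation C := R[i].
Variable n : nat.
Implicit Types (u v : 'cV[C]_(2 * n)) (p q : 'I_(2 * n)) (h : 'M[R]_(2 * n)).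

Lemma mode_opD u v : mode_op (u + v) = mode_op u + mode_op v.
Proof.
by rewrite /mode_op -big_split; apply: eq_bigr => p _; rewrite mxE scalerDl.
Qed.

Lemma mode_opZ a u : mode_op (a *: u) = a *: mode_op u.
Proof.
by rewrite /mode_op scaler_sumr; apply: eq_bigr => p _; rewrite mxE scalerA.
Qed.

Lemma mode_op0 : mode_op (0 : 'cV[C]_(2 * n)) = 0.
Proof. by rewrite /mode_op big1 // => p _; rewrite mxE scale0r. Qed.

Lemma mode_op_sum I (s : seq I) (P : pred I) (F : I -> 'cV[C]_(2 * n)) :
  mode_op (\sum_(i <- s | P i) F i) = \sum_(i <- s | P i) mode_op (F i).
Proof. by apply: (big_morph (@mode_op R n)); [exact: mode_opD | exact: mode_op0]. Qed.

Lemma adj_mode_op u : adj (mode_op u) = mode_op (map_mx Num.conj u).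
Proof.
by rewrite /mode_op adj_sum; apply: eq_bigr => p _; rewrite adjZ adj_maj mxE.
Qed.

Lemma maj_mode_car p u :
  maj R p * mode_op u + mode_op u * maj R p = (u p 0 *+ 2)%:M.
Proof.
rewrite /mode_op mulr_sumr mulr_suml -big_split /=.
rewrite (eq_bigr (fun q => (u q 0 * ((p == q)%:R *+ 2))%:M)); last first.
  by move=> q _; rewrite -scalerAr -scalerAl -scalerDr maj_car scale_scalar_mx.
rewrite (bigD1 p) //= eqxx big1 => [|q /negbTE pq].
  by rewrite addr0 mulrnAr mulr1.
by rewrite eq_sym pq mul0rn mulr0 raddf0.
Qed.

Lemma mode_op_car u v :
  mode_op u * mode_op v + mode_op v * mode_op u = ((u^T *m v) 0 0 *+ 2)%:M.
Proof.
rewrite {1 4}/mode_op mulr_suml mulr_sumr -big_split /=.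
rewrite (eq_bigr (fun p => (u p 0 * (v p 0 *+ 2))%:M)); last first.
  by move=> p _; rewrite -scalerAr -scalerAl -scalerDr maj_mode_car scale_scalar_mx.
rewrite -(raddf_sum (@scalar_mx C _)) mxE -sumrMnl; congr (_%:M).
by apply: eq_bigr => p _; rewrite mxE mulrnAr.
Qed.

Lemma mode_op_adj_car u :
  adj (mode_op u) * mode_op u + mode_op u * adj (mode_op u) = (normsq u *+ 2)%:M.
Proof.
by rewrite adj_mode_op mode_op_car /normsq /dot adj_map_trmx map_trmx.
Qed.

(** For [b = mode_op u], the anticommutator with its adjoint is the scalar [2 |u|^2], so the squared
    norms of [b psi] and of its adjoint applied to [psi] add up to the right-hand side. *)
Lemma normsq_mode_op_le u (psi : 'cV[C]_(Fdim n)) :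
  normsq (mode_op u *m psi) <= 2 * normsq u * normsq psi.
Proof.
have -> : 2 * normsq u * normsq psi = normsq (mode_op u *m psi)
    + normsq (adj (mode_op u) *m psi).
  rewrite {3 4}/normsq !dot_adjl adjK !mulmxA -dotDr -mulmxDl.
  rewrite -[_ + _]/(adj (mode_op u) * mode_op u + mode_op u * adj (mode_op u)).
  by rewrite mode_op_adj_car mul_scalar_mx dotZr -/(normsq psi) mulr_natl.
by rewrite lerDl normsq_ge0.
Qed.

(** The commutator of a quadratic with a linear expression in Majoranas is linear; the scalar part
    of [H0] drops out. *)
Lemma H0_mode_op h u : trmx h = - h ->
  H0 h * mode_op u - mode_op u * H0 h = iC R *: mode_op (cplx h *m u).
Proof.
move=> hT; rewrite /H0 mulrDl mulrDr opprD addrACA.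
rewrite -[(_)%:M * _]/((_)%:M *m _) -[_ * (_)%:M]/(_ *m (_)%:M).
rewrite mul_scalar_mx mul_mx_scalar subrr add0r -scalerAl -scalerAr -scalerBr.
set S := \sum_(p < 2 * n) _; set B := mode_op u.
suff -> : S * B - B * S = 4 *: mode_op (cplx h *m u).
  by rewrite scalerA divfK // pnatr_eq0.
have hq p q : h q p = - h p q.
  by have := congr1 (fun M : 'M_(2 * n) => M p q) hT; rewrite !mxE.
(* Rewriting the commutator through two anticommutators makes both of them scalars. *)
have comm p q : maj R p * maj R q * B - B * (maj R p * maj R q)
    = (u q 0 *+ 2) *: maj R p - (u p 0 *+ 2) *: maj R q.
  have -> : maj R p * maj R q * B - B * (maj R p * maj R q)
    = maj R p * (maj R q * B + B * maj R q) - (maj R p * B + B * maj R p) * maj R q.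
    by rewrite mulrDr mulrDl !mulrA opprD addrA addrK.
  rewrite !maj_mode_car.
  by rewrite -[_ * (_)%:M]/(_ *m (_)%:M) -[(_)%:M * _]/((_)%:M *m _) mul_scalar_mx mul_mx_scalar.
have -> : S * B - B * S = \sum_p \sum_q (h p q)%:C *:
    ((u q 0 *+ 2) *: maj R p - (u p 0 *+ 2) *: maj R q).
  rewrite /S mulr_suml mulr_sumr -sumrB; apply: eq_bigr => p _.
  rewrite mulr_suml mulr_sumr -sumrB; apply: eq_bigr => q _.
  by rewrite -scalerAl -scalerAr -scalerBr comm.
have e1 : \sum_p \sum_q (h p q)%:C *: ((u q 0 *+ 2) *: maj R p)
    = 2 *: mode_op (cplx h *m u).
  rewrite /mode_op scaler_sumr; apply: eq_bigr => p _.
  rewrite scalerA !mxE mulr_sumr scaler_suml; apply: eq_bigr => q _.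
  by rewrite scalerA mxE; congr (_ *: _); ring.
(* By antisymmetry of [h] the two terms of [comm] contribute equally, each giving a factor 2; the
   total 4 cancels the 1/4 of [H0]. *)
rewrite -[4]/((2 + 2)%N%:R) natrD scalerDl -e1.
under eq_bigr => p _ do under eq_bigr => q _ do rewrite scalerBr.
under eq_bigr => p _ do rewrite sumrB.
rewrite sumrB; congr (_ + _); rewrite exchange_big -sumrN; apply: eq_bigr => p _.
rewrite -sumrN; apply: eq_bigr => q _.
by rewrite hq -scaleNr; congr (_ *: _); rewrite raddfN opprK.
Qed.

(** Taking adjoints reverses [c_p c_q]; the sign from antisymmetry of [h] cancels the one from
    conjugating [i]. *)
Lemma H0_hermitian h : trmx h = - h -> is_hermitian (H0 h).
Proof.
move=> hT; rewrite /is_hermitian /H0 adjD adj_scalar adjZ; congr (_%:M + _).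
  exact: conj_realC.
have hq p q : h q p = - h p q.
  by have := congr1 (fun M : 'M_(2 * n) => M p q) hT; rewrite !mxE.
have -> : adj (\sum_(p < 2 * n) \sum_(q < 2 * n) (h p q)%:C *: (maj R p * maj R q))
   = - \sum_(p < 2 * n) \sum_(q < 2 * n) (h p q)%:C *: (maj R p * maj R q).
  rewrite adj_sum [in RHS]exchange_big -sumrN; apply: eq_bigr => p _.
  rewrite adj_sum -sumrN; apply: eq_bigr => q _.
  rewrite adjZ adjM !adj_maj conj_realC hq -scaleNr; congr (_ *: _).
  by apply/eqP; rewrite eq_complex /= ?opprK ?oppr0 !eqxx.
rewrite scalerN -scaleNr; congr (_ *: _).
rewrite conjCM conj_iC mulNr opprK; congr (_ * _).
by apply/CrealP; rewrite realV realn.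
Qed.

(** A mode with no amplitude on the impurity anticommutes with each impurity Majorana, and every
    monomial contains an even number of them. *)
Lemma Himp_mode_op m (hm : (m <= 2 * n)%N) (g : {ffun 'I_m -> bool} -> C) u :
  (forall p : 'I_m, u (widen_ord hm p) 0 = 0) ->
  Himp hm g * mode_op u = mode_op u * Himp hm g.
Proof.
move=> u0; rewrite /Himp mulr_suml mulr_sumr; apply: eq_bigr => x ex.
rewrite -scalerAl -scalerAr; congr (_ *: _).
have anti (p : 'I_m) : maj R (widen_ord hm p) * mode_op u = - (mode_op u * maj R (widen_ord hm p)).
  by apply/eqP; rewrite -addr_eq0 maj_mode_car u0 mul0rn raddf0.
rewrite /maj_monomial.
have -> : \prod_(p < m) (if x p then maj R (widen_ord hm p) else 1) * mode_op u
   = (-1) ^+ (\sum_(p < m) x p)%N *: (mode_op u *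
       \prod_(p < m) (if x p then maj R (widen_ord hm p) else 1)).
  elim: (index_enum _) => [|p s IHs]; first by rewrite !big_nil mulr1 mul1r scale1r.
  rewrite !big_cons -mulrA IHs -scalerAr exprD -scalerA; case: (x p) => /=.
    by rewrite expr1 scaleN1r (mulrA (maj R _)) anti mulNr scalerN mulrA.
  by rewrite scale1r !mul1r.
suff -> : (\sum_(p < m) x p)%N = #|[pred p | x p]| by rewrite -signr_odd (negbTE ex) scale1r.
by rewrite -sum1_card [RHS]big_mkcond; apply: eq_bigr => p _; rewrite inE; case: (x p).
Qed.

End Commutators.

(** * Ground states *)
Section GroundStates.
Variable R : realType.
Local Notation C := R[i].

Lemma conj_eq_real (z : C) : z^*%R = z -> z = (complex.Re z)%:C.
Proof.
case: z => a b [] /eqP; rewrite -subr_eq0 -opprD oppr_eq0 -mulr2n mulrn_eq0 /=.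
by move=> /eqP ->.
Qed.

(** Minimality is given in variational form, as positivity of [A - E], which the iteration below
    requires. The successor dimension makes the diagonal nonempty. *)
Lemma hermitian_min_eigenvalue k (A : 'M[C]_k.+1) : is_hermitian A ->
  exists E : R, exists v : 'cV[C]_k.+1,
    [/\ v != 0, A *m v = E%:C *: v
      & forall w : 'cV[C]_k.+1, E%:C * normsq w <= dot w (A *m w)].
Proof.
move=> hA; have [P [d [PP PP' eA]]] := hermitian_diag hA.
have eD : diag_mx d = P *m A *m adj P.
  by rewrite eA !mulmxA PP' mul1mx -(mulmxA _ P) PP' mulmx1.
have d_real i : d 0 i = (complex.Re (d 0 i))%:C.
  apply: conj_eq_real; have : adj (diag_mx d) = diag_mx d.
    by rewrite eD !adjM adjK hA mulmxA.
  by move/(congr1 (fun M : 'M_k.+1 => M i i)); rewrite adjE !mxE eqxx !mulr1n.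
pose i0 := [arg min_(i < ord0) complex.Re (d 0 i)]%O.
have i0_min i : d 0 i0 <= d 0 i.
  rewrite (d_real i) (d_real i0) lecR /i0.
  by case: Order.TotalTheory.arg_minP => // j _ /(_ i isT).
exists (complex.Re (d 0 i0)), (adj P *m delta_mx i0 0); rewrite -d_real; split.
- rewrite -normsq_eq0 normsq_isometry ?adjK // normsq_eq0.
  apply/eqP => /(congr1 (fun M : 'cV_k.+1 => M i0 0)); rewrite !mxE !eqxx.
  by apply/eqP; rewrite oner_eq0.
- rewrite {1}eA -!mulmxA (mulmxA P) PP' mul1mx scalemxAr; congr (_ *m _).
  apply/matrixP => i j; rewrite mul_diag_mx !mxE.
  by case: eqP => [->|_] //=; rewrite !mulr0.
move=> w; rewrite eA -!mulmxA -{1}(adjK P) -dot_adjl adjK dot_diag.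
rewrite -(normsq_isometry w PP) normsqE mulr_sumr.
by apply: ler_sum => i _; rewrite ler_wpM2r ?exprn_ge0.
Qed.

Lemma normalized_ground_stateP k (A : 'M[C]_k) (E : C) (v : 'cV[C]_k) :
  v != 0 -> A *m v = E *: v -> (forall w : 'cV[C]_k, E * normsq w <= dot w (A *m w)) ->
  exists2 c : C, normsq (c *: v) = 1 & normalized_ground_state A (c *: v).
Proof.
move=> v0 Av Emin; have nv : normsq (sqrtC (normsq v)^-1 *: v) = 1.
  rewrite normsqZ ger0_norm ?sqrtC_ge0 ?invr_ge0 ?normsq_ge0 // sqrtCK.
  by rewrite mulVf // normsq_eq0.
exists (sqrtC (normsq v)^-1) => //; split.
  by apply/matrixP => i j; rewrite !ord1 [LHS]nv mxE.
exists E; split; first by rewrite -scalemxAr Av !scalerA mulrC.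
move=> mu w w0 Aw; have := Emin w; rewrite Aw dotZr -/(normsq w).
by rewrite ler_pM2r // normsq_gt0.
Qed.

(* Apply each nilpotent operator in turn unless it already kills the vector;
   the anticommutation relations preserve the earlier kernels. *)
Lemma common_kernel_eigenvector k (A : 'M[C]_k) (E : C) (s : seq 'M[C]_k) (v : 'cV[C]_k) :
  {in s, forall B, A *m B = B *m A} ->
  {in s &, forall B D, B *m D + D *m B = 0} ->
  v != 0 -> A *m v = E *: v ->
  exists w : 'cV[C]_k, [/\ w != 0, A *m w = E *: w & {in s, forall B : 'M_k, B *m w = 0}].
Proof.
move=> comm anti v0 Av; elim: s comm anti => [|B s IHs] comm anti.
  by exists v; split.
have [|B' D' hB hD|w [w0 Aw sw]] := IHs.
- by move=> B' hB; apply: comm; rewrite inE hB orbT.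
- by apply: anti; rewrite inE ?hB ?hD orbT.
have Bs : B \in B :: s by rewrite mem_head.
have BB : B *m B = 0.
  apply/eqP; have /eqP := anti _ _ Bs Bs; rewrite -mulr2n -scaler_nat scaler_eq0.
  by rewrite pnatr_eq0.
have [Bw|Bw] := eqVneq (B *m w) 0.
  by exists w; split=> // D; rewrite inE => /orP[/eqP->|/sw].
exists (B *m w); split=> //; first by rewrite mulmxA comm // -mulmxA Aw scalemxAr.
move=> D; rewrite inE => /orP[/eqP->|Ds]; first by rewrite mulmxA BB mul0mx.
have : D *m B + B *m D = 0 by apply: anti => //; rewrite inE Ds orbT.
move/eqP; rewrite addr_eq0 => /eqP DB.
by rewrite mulmxA DB mulNmx -mulmxA sw // mulmx0 oppr0.
Qed.

End GroundStates.

(** * The alternating direction iteration *)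
Section ADI.
Variable R : realType.
Local Notation C := R[i].

(** The product of the commuting factors [t + A] applied to [v], as a fold so that inductions
    advance the vector by one shift. *)
Definition adi p (A : 'M[C]_p) (ts : seq R) (v : 'cV[C]_p) : 'cV[C]_p :=
  foldl (fun w t => t%:C *: w + A *m w) v ts.

Lemma adi_commute p (A B : 'M[C]_p) ts v : A *m B = B *m A ->
  adi A ts (B *m v) = B *m adi A ts v.
Proof.
move=> AB; elim: ts v => //= t ts IHts v; rewrite -IHts; congr (adi _ _ _).
by rewrite mulmxDr -scalemxAr !mulmxA AB.
Qed.

Lemma adi_diag p (d : 'rV[C]_p) ts v i :
  adi (diag_mx d) ts v i 0 = \prod_(t <- ts) (t%:C + d 0 i) * v i 0.
Proof.
elim: ts v => [|t ts IHts] v /=; first by rewrite big_nil mul1r.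
rewrite IHts big_cons mul_diag_mx !mxE; ring.
Qed.

(** Each shift uses the relation on the kernel of [U] once. It replaces [b] by [t b + E b], whose
    [i]-th iterate involves iterates [i] and [i + 1] of [b]; hence one condition per shift. *)
Lemma adi_intertwine p n m (A : 'M[C]_p) (E : 'M[C]_n) (X : 'M[C]_(p, n))
    (U : 'M[C]_(m, n)) ts b :
  (forall a : 'cV_n, U *m a = 0 -> X *m (E *m a) = - (A *m (X *m a))) ->
  (forall i, (i < size ts)%N -> U *m iter i (mulmx E) b = 0) ->
  X *m adi E ts b = adi (- A) ts (X *m b).
Proof.
move=> XE; elim: ts b => //= t ts IHts b Ub; rewrite IHts.
  by rewrite mulmxDr -scalemxAr XE ?mulNmx //; apply: (Ub 0%N).
move=> i lti; have -> : iter i (mulmx E) (t%:C *: b + E *m b)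
    = t%:C *: iter i (mulmx E) b + iter i.+1 (mulmx E) b.
  elim: i {lti} => //= i ->; by rewrite mulmxDr -scalemxAr.
by rewrite mulmxDr -scalemxAr !Ub ?scaler0 ?addr0 // ltnW.
Qed.

(** The two sides differ by [4 t <w, A w>]. *)
Lemma normsq_shift_le p (A : 'M[C]_p) (t : R) (w : 'cV[C]_p) :
  is_hermitian A -> 0 <= dot w (A *m w) -> 0 <= t ->
  normsq (t%:C *: w - A *m w) <= normsq (t%:C *: w + A *m w).
Proof.
move=> hA A0 t0; rewrite -[- (A *m w)]scaleN1r /normsq !dotDl !dotDr !dotZl !dotZr.
have -> : dot (A *m w) w = dot w (A *m w) by rewrite dot_adjl hA.
rewrite conj_realC [(-1)^*%R]rmorphN1 -subr_ge0.
set x := dot w (A *m w); set y := dot (A *m w) _; set z := dot w w.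
have -> : t%:C * (t%:C * z) + t%:C * x + (t%:C * x + y)
    - (t%:C * (t%:C * z) + t%:C * (-1 * x) + (-1 * (t%:C * x) + -1 * (-1 * y)))
    = (t%:C * x) *+ 4 by ring.
by rewrite mulrn_wge0 // mulr_ge0 // ler0c.
Qed.

(** Signs are switched one factor at a time: all factors commute, so the factor being switched can
    be moved to act last, where the single-shift inequality applies. *)
Lemma adi_contract p (A : 'M[C]_p) ts (v : 'cV[C]_p) :
  is_hermitian A -> (forall w : 'cV[C]_p, 0 <= dot w (A *m w)) -> all (fun t => 0 <= t) ts ->
  normsq (adi (- A) ts v) <= normsq (adi A ts v).
Proof.
move=> hA A0; elim: ts v => //= t ts IHts v /andP[t0 ts0].
apply: le_trans (IHts _ ts0) _.
have adi_shift (B : 'M_p) : A *m B = B *m A ->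
    adi A ts (t%:C *: v + B *m v) = t%:C *: adi A ts v + B *m adi A ts v.
  move=> AB; have shift w : t%:C *: w + B *m w = (t%:C%:M + B) *m w.
    by rewrite mulmxDl mul_scalar_mx.
  by rewrite !shift adi_commute // mulmxDr mulmxDl AB mul_scalar_mx mul_mx_scalar.
by rewrite !adi_shift ?mulmxN ?mulNmx // normsq_shift_le.
Qed.

Lemma stack_constraints m n k (F : nat -> 'M[C]_(m, n)) :
  exists M : 'M[C]_(k * m, n),
    forall a : 'cV_n, M *m a = 0 -> forall i, (i < k)%N -> F i *m a = 0.
Proof.
elim: k => [|k [M hM]]; first by exists 0.
exists (col_mx (F k) M : 'M_(m + k * m, n)) => a; rewrite mul_col_mx => /eqP.
rewrite col_mx_eq0 => /andP[/eqP Fa /eqP /hM Ma] i.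
by rewrite ltnS leq_eqVlt => /orP[/eqP->|/Ma].
Qed.

End ADI.

(** * Contraction on a subspace of small codimension *)

Section Decay.
Variable R : realType.
Local Notation C := R[i].

Lemma realCM (x y : R) : (x * y)%:C = x%:C * y%:C.
Proof. exact: (rmorphM (real_complex R)). Qed.

Lemma realC2 : (2 : R)%:C = 2 :> C.
Proof. exact: (rmorph_nat (real_complex R) 2). Qed.

Lemma normsq_realM (x : R) (z : C) : `|x%:C * z| ^+ 2 = (x ^+ 2)%:C * `|z| ^+ 2.
Proof.
by rewrite normrM exprMn normCK conj_realC expr2 -realCM.
Qed.

Lemma iter_mulmxN p (E : 'M[C]_p) i (b : 'cV_p) :
  iter i (mulmx (- E)) b = (-1) ^+ i *: iter i (mulmx E) b.
Proof.
elim: i => [|i /= ->]; first by rewrite scale1r.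
by rewrite mulNmx -scalemxAr exprS mulN1r scaleNr.
Qed.

Lemma iter_mulmx_assoc p n (E : 'M[C]_p) i (D : 'M_(p, n)) (b : 'cV_n) :
  iter i (mulmx E) D *m b = iter i (mulmx E) (D *m b).
Proof. by elim: i => //= i <-; rewrite mulmxA. Qed.

Lemma prod_complex (ts : seq R) (f : R -> R) :
  \prod_(t <- ts) (f t)%:C = (\prod_(t <- ts) f t)%:C.
Proof. by rewrite (rmorph_prod (real_complex R)). Qed.

(** A vector splits into its zero-mode part, which [X] kills after [m] conditions, and
    [prod(t + eps) b], for which the iteration costs [m] conditions per shift. Here [r] bounds the
    squared contraction factor. *)
Lemma adi_decay p n m (A : 'M[C]_p) (X : 'M_(p, n)) (U : 'M_(m, n))
    (eps : 'I_n -> R) (ts : seq R) (r : R) :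
  is_hermitian A -> (forall w : 'cV_p, 0 <= dot w (A *m w)) ->
  (forall a : 'cV_n, U *m a = 0 ->
     X *m (diag_mx (\row_j (eps j)%:C) *m a) = - (A *m (X *m a))) ->
  (forall a : 'cV_n, normsq (X *m a) <= 2 * normsq a) ->
  (forall a : 'cV_n, diag_mx (\row_j (eps j)%:C) *m a = 0 -> U *m a = 0 -> X *m a = 0) ->
  all (fun t => 0 < t) ts -> (forall j, 0 <= eps j) -> 0 <= r ->
  (forall j, eps j != 0 -> (\prod_(t <- ts) (t - eps j)) ^+ 2
     <= r * (\prod_(t <- ts) (t + eps j)) ^+ 2) ->
  exists M : 'M[C]_(m + size ts * m, n),
    forall a : 'cV_n, M *m a = 0 -> normsq (X *m a) <= (2 * r)%:C * normsq a.
Proof.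
set E := diag_mx _ => hA A0 XE X2 XZ ts0 eps0 r0 ratio.
pose P j := \prod_(t <- ts) (t + eps j); pose Q j := \prod_(t <- ts) (t - eps j).
have P0 j : P j != 0.
  apply: lt0r_neq0; rewrite /P; elim: ts ts0 {P Q ratio} => [|t ts IH] /=.
    by rewrite big_nil.
  by case/andP=> t0 ts0; rewrite big_cons mulr_gt0 ?ltr_wpDr ?IH.
(* [D1] projects onto the zero modes; [D2] kills them and divides each other mode by [P j], so that
   [adi E ts] restores it. *)
pose D1 : 'M[C]_n := diag_mx (\row_j (eps j == 0)%:R).
pose D2 : 'M[C]_n := diag_mx (\row_j ((eps j != 0)%:R * (P j)^-1)%:C).
have [M hM] := stack_constraints (size ts) (fun i => U *m iter i (mulmx E) D2).
exists (col_mx (U *m D1) M) => a; rewrite mul_col_mx => /eqP.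
rewrite col_mx_eq0 => /andP[/eqP UD /eqP /hM Ub].
pose b := D2 *m a.
have Ub' i : (i < size ts)%N -> U *m iter i (mulmx E) b = 0.
  by move=> /Ub; rewrite -mulmxA iter_mulmx_assoc.
have b_split : a = D1 *m a + adi E ts b.
  apply/matrixP => j k; rewrite ord1 mxE adi_diag /b !mul_diag_mx !mxE.
  under eq_bigr => t _ do rewrite -(rmorphD (real_complex R)).
  rewrite prod_complex -/(P j) mulrA -realCM.
  have [e|e] := eqVneq (eps j) 0; first by rewrite !mul0r mulr0 mul0r addr0 mul1r.
  by rewrite [true%:R * _]mul1r divff // mul1r mul0r add0r.
have XD : X *m (D1 *m a) = 0.
  apply: XZ; last by rewrite mulmxA.
  apply/matrixP => j k; rewrite !mul_diag_mx !mxE.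
  by have [->|e] := eqVneq (eps j) 0; rewrite /= ?mul0r ?mulr0.
rewrite {1}b_split mulmxDr XD add0r (adi_intertwine XE Ub').
apply: (@le_trans _ _ (normsq (adi A ts (X *m b)))).
  apply: adi_contract => //; apply/allP => t /(allP ts0); exact: ltW.
(* The same intertwining with both signs reversed turns [prod(t + A) X b] back into
   [X prod(t - E) b]. *)
have XEN (c : 'cV_n) : U *m c = 0 -> X *m (- E *m c) = - (- A *m (X *m c)).
  by move=> Uc; rewrite !mulNmx mulmxN XE // !opprK.
rewrite -[A in adi A]opprK -(adi_intertwine XEN); last first.
  by move=> i /Ub' Ui; rewrite iter_mulmxN -scalemxAr Ui scaler0.
apply: le_trans (X2 _) _; rewrite realCM -mulrA.
rewrite realC2 ler_pM2l ?ltr0n // !normsqE mulr_sumr; apply: ler_sum => j _.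
rewrite /E -raddfN adi_diag.
have -> : \prod_(t <- ts) (t%:C + (- \row_j (eps j)%:C) 0 j) = (Q j)%:C :> C.
  rewrite -prod_complex; apply: eq_bigr => t _; rewrite !mxE.
  by rewrite (rmorphB (real_complex R)).
rewrite /b mul_diag_mx !mxE mulrA -realCM normsq_realM.
apply: ler_wpM2r; first by rewrite exprn_ge0.
rewrite lecR; have [e|e] := eqVneq (eps j) 0; first by rewrite /= mul0r mulr0 expr0n.
by rewrite mul1r exprMn exprVn ler_pdivrMr ?exprn_even_gt0 ?P0 //; apply: ratio.
Qed.

End Decay.

(** * The geometric grid of shifts *)
Section Grid.
Variable R : realType.
Implicit Types (e t : R) (ts : seq R).

Lemma prod_shift_le ts e : 0 <= e -> all (fun t => 0 < t) ts ->
  (\prod_(t <- ts) (t - e)) ^+ 2 <= (\prod_(t <- ts) (t + e)) ^+ 2.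
Proof.
move=> e0; elim: ts => [|t ts IHts] /=; first by rewrite !big_nil.
case/andP => t0 ts0; rewrite !big_cons !exprMn; apply: ler_pM; rewrite ?sqr_ge0 ?IHts //.
nra.
Qed.

(** The shift [t] within a factor 2 of [e] gives [(t - e) / (t + e) <= 1/3]; the other shifts
    contribute at most 1. *)
Lemma prod_shift_good ts e t : 0 <= e -> all (fun t => 0 < t) ts ->
  t \in ts -> e <= t -> t <= 2 * e ->
  (\prod_(t <- ts) (t - e)) ^+ 2 <= 9^-1 * (\prod_(t <- ts) (t + e)) ^+ 2.
Proof.
move=> e0 ts0 tts et te; have := ts0; rewrite (perm_all _ (perm_to_rem tts)) /=.
case/andP=> t0 rem0; rewrite !(perm_big _ (perm_to_rem tts)) !big_cons !exprMn (mulrA 9^-1).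
apply: ler_pM; rewrite ?sqr_ge0 ?prod_shift_le //.
(* [(t + e)^2 - 9 (t - e)^2] factors as [4 (2 e - t) (2 t - e)]. *)
have : 0 <= (2 * e - t) * (2 * t - e) by apply: mulr_ge0; lra.
nra.
Qed.

(** The point [t] serves the energies in [[t/2, t]], so stopping at [2^-(N-1)] covers everything
    down to [2^-N]. *)
Definition dyadic_grid (N : nat) : seq R := [seq 2^-1 ^+ l | l <- iota 0 N].

Definition shifts (N s : nat) : seq R := flatten (nseq s (dyadic_grid N)).

Lemma size_shifts N s : size (shifts N s) = (s * N)%N.
Proof. by rewrite size_flatten /shape map_nseq sumn_nseq size_map size_iota mulnC. Qed.

Lemma dyadic_grid_gt0 N : all (fun t => 0 < t) (dyadic_grid N).
Proof. by apply/allP => t /mapP[l _ ->]; rewrite exprn_gt0 // invr_gt0. Qed.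

Lemma shifts_gt0 N s : all (fun t => 0 < t) (shifts N s).
Proof. by elim: s => //= s IHs; rewrite /shifts /= all_cat dyadic_grid_gt0. Qed.

Lemma dyadic_grid_good N e : (0 < N)%N -> 2^-1 ^+ N <= e <= 1 ->
  exists2 t, t \in dyadic_grid N & e <= t <= 2 * e.
Proof.
case: N => // N _; elim: N => [|N IHN] /andP[ge le].
  by exists 1; [rewrite inE | rewrite le /=; move: ge; rewrite expr1; lra].
have [e_small|e_big] := ltP e (2^-1 ^+ N.+1).
  exists (2^-1 ^+ N.+1); first by apply: map_f; rewrite mem_iota ltnS leqnn.
  by rewrite ltW //=; move: ge; rewrite exprS; lra.
have [|t tg ht] := IHN; first by rewrite e_big.
exists t => //; case/mapP: tg => l; rewrite mem_iota => /= ltl ->.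
by apply: map_f; rewrite mem_iota /= ltnS ltnW.
Qed.

Lemma shifts_ratio N s e : (0 < N)%N -> 2^-1 ^+ N <= e <= 1 ->
  (\prod_(t <- shifts N s) (t - e)) ^+ 2
  <= 9^-1 ^+ s * (\prod_(t <- shifts N s) (t + e)) ^+ 2.
Proof.
move=> N0 eN; have e0 : 0 <= e.
  by case/andP: eN => + _; apply: le_trans; rewrite exprn_ge0 // invr_ge0.
have [t tg /andP[et te]] := dyadic_grid_good N0 eN.
elim: s => [|s IHs]; first by rewrite /shifts !big_nil mul1r.
rewrite /shifts /= !big_cat /= !exprMn (exprS _ s) [leRHS]mulrACA.
apply: ler_pM; rewrite ?sqr_ge0 //.
by apply: prod_shift_good tg et te => //; apply: dyadic_grid_gt0.
Qed.

(** This instance of [1 + x <= exp x] yields both numerical bounds below, on [ln 2] and on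
    [expR 1]. *)
Lemma expR_half_ge : 2^-1 <= expR (- 2^-1) :> R.
Proof. by apply: le_trans (expR_ge1Dx _); lra. Qed.

Lemma ln2_ge : 2^-1 <= ln 2 :> R.
Proof.
rewrite -[leLHS]expRK ler_ln ?posrE ?expR_gt0 //.
have := expR_half_ge; rewrite expRN => h.
by rewrite -lef_pV2 ?posrE ?expR_gt0.
Qed.

Lemma expR1_le : expR 1 <= 9 :> R.
Proof.
have e1 : expR (-1) = expR (- 2^-1) ^+ 2 :> R by rewrite expr2 -expRD; congr expR; lra.
have : 4^-1 <= expR (-1) :> R by rewrite e1; have := expR_half_ge; nra.
rewrite expRN lef_pV2 ?posrE ?expR_gt0 //; lra.
Qed.

(** Take the least [N]: then [2^-(N-1)] exceeds [w], so [2^N <= 2 / w], and [ln 2 >= 1/2] converts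
    this to logarithms. *)
Lemma dyadic_depth (w : R) : 0 < w -> w <= 1 ->
  exists N : nat, [/\ (0 < N)%N, 2^-1 ^+ N <= w & N%:R / 2 <= ln (2 / w)].
Proof.
move=> w0 w1; pose P N := (0 < N)%N && (2^-1 ^+ N <= w).
have exP : exists N, P N.
  exists (Num.bound w^-1).+1; rewrite /P /= exprVn -[w in leRHS]invrK.
  rewrite lef_pV2 ?posrE ?invr_gt0 ?exprn_gt0 //; apply: ltW.
  apply: (@lt_trans _ _ (Num.bound w^-1)%:R); first by rewrite archi_boundP // invr_ge0 ltW.
  by rewrite -natrX ltr_nat ltnW // ltn_expl.
case: (ex_minnP exP) => N /andP[N0 leN] minN; exists N; split=> //.
have le2 : 2 ^+ N <= 2 / w.
  (* For [N = 1] the predecessor is excluded by positivity, and [w <= 1] is used instead of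
     minimality. *)
  case: N N0 leN minN => // -[|N] _ leN minN.
    by rewrite expr1 ler_pdivlMr //; lra.
  have [/(minN N.+1)|] := boolP (P N.+1); first by rewrite ltnn.
  rewrite /P /= -ltNge => lt; rewrite exprS ler_pM2l //.
  by rewrite -[leLHS]invrK -exprVn lef_pV2 ?posrE ?exprn_gt0 ?invr_gt0 // ltW.
apply: (@le_trans _ _ (ln (2 ^+ N))).
  by rewrite lnXn // -(mulr_natl (ln 2)) ler_wpM2l // ln2_ge.
by rewrite ler_ln ?posrE ?exprn_gt0 ?divr_gt0.
Qed.

(** Since [N <= 2 L], the exponent is at most [s + 2], with ample room in the constant 14. Then
    [9^-s <= exp(-s)], and [expR 2] absorbs the excess 2. *)
Lemma decay_numerics (j m N s : nat) (L : R) : (0 < m)%N -> (0 < N)%N ->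
  N%:R / 2 <= L -> (j <= m + s.+1 * N * m)%N ->
  2 * 9^-1 ^+ s <= 2 * expR 2 * expR (- j%:R / (14 * m%:R * L)).
Proof.
move=> m0 N0 NL hj.
have m0' : 0 < m%:R :> R by rewrite ltr0n.
have N1 : 1 <= N%:R :> R by rewrite ler1n.
have L0 : 0 < L by lra.
have : j%:R / (14 * m%:R * L) <= s%:R + 2.
  rewrite ler_pdivrMr ?mulr_gt0 //.
  have : j%:R <= m%:R + (s%:R + 1) * N%:R * m%:R :> R.
    by rewrite -(natrD _ s 1) addn1 -!natrM -natrD ler_nat.
  move/le_trans; apply.
  have s0 : 0 <= s%:R :> R by [].
  have -> : (s%:R + 2) * (14 * m%:R * L) = m%:R * ((s%:R + 2) * (14 * L)) by ring.
  have -> : m%:R + (s%:R + 1) * N%:R * m%:R = m%:R * (1 + (s%:R + 1) * N%:R) :> R by ring.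
  by rewrite ler_pM2l //; nra.
move=> hexp; rewrite -mulrA ler_pM2l // mulNr -expRD.
apply: (@le_trans _ _ (expR (- s%:R))); last by rewrite ler_expR; lra.
rewrite expRN -[s%:R]mulr1 expRM_natl exprVn lef_pV2 ?posrE ?exprn_gt0 ?expR_gt0 //.
by rewrite lerXn2r ?nnegrE ?expR_ge0 ?expR1_le.
Qed.

End Grid.

(** * Correlation matrix of the ground state *)
Section Correlations.
Variable R : realType.
Local Notation C := R[i].
Variables (n : nat) (u : 'I_n -> 'cV[C]_(2 * n)).

Definition mode_mx : 'M[C]_(2 * n, n) := \matrix_(p, j) u j p 0.

(** The matrix X of the overview, with columns [b_j psi]. *)
Definition excitation (psi : 'cV[C]_(Fdim n)) : 'M[C]_(Fdim n, n) :=
  \matrix_(y, j) (mode_op (u j) *m psi) y 0.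

Lemma mode_mx_mul (a : 'cV[C]_n) : mode_mx *m a = \sum_j a j 0 *: u j.
Proof.
apply/matrixP => p k; rewrite ord1 !mxE summxE; apply: eq_bigr => j _.
by rewrite !mxE mulrC.
Qed.

Lemma excitation_mul psi (a : 'cV[C]_n) :
  excitation psi *m a = mode_op (mode_mx *m a) *m psi.
Proof.
rewrite mode_mx_mul mode_op_sum mulmx_suml.
apply/matrixP => y k; rewrite ord1 !mxE summxE; apply: eq_bigr => j _.
by rewrite mode_opZ -scalemxAl !mxE mulrC.
Qed.

Lemma excitation_gram psi :
  adj (excitation psi) *m excitation psi =
  \matrix_(j, k) expect psi (adj (mode_op (u j)) * mode_op (u k)).
Proof.
apply/matrixP => j k; rewrite [RHS]mxE /expect -[_ * _]/(_ *m _) !mulmxA.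
rewrite -mulmxA -adjM !mxE; apply: eq_bigr => y _.
by rewrite !adjE !mxE.
Qed.

Lemma mode_mx_isometry :
  (forall j k, (adj (u j) *m u k) 0 0 = (j == k)%:R) -> adj mode_mx *m mode_mx = 1%:M.
Proof.
move=> ortho; apply/matrixP => j k; rewrite [RHS]mxE -ortho !mxE.
by apply: eq_bigr => p _; rewrite !adjE !mxE.
Qed.

(** The anticommutator of two modes is twice their bilinear product, without conjugation; any
    diagonal entry reveals it. *)
Lemma mode_mx_isotropic :
  (forall j k, mode_op (u j) * mode_op (u k) + mode_op (u k) * mode_op (u j) = 0) ->
  mode_mx^T *m mode_mx = 0.
Proof.
move=> anti; apply/matrixP => j k; have := anti j k; rewrite mode_op_car.
move/(congr1 (fun M : 'M_(Fdim n) => M 0 0)); rewrite mxE eqxx mulr1n [RHS]mxE.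
move/eqP; rewrite mulrn_eq0 /= => /eqP e; rewrite [RHS]mxE -[RHS]e !mxE.
by apply: eq_bigr => p _; rewrite !mxE.
Qed.

Lemma mode_mx_eigen (h : 'M[R]_(2 * n)) (eps : 'I_n -> R) (a : 'cV[C]_n) :
  (forall j, cplx h *m u j = (iC R * (eps j)%:C) *: u j) ->
  cplx h *m (mode_mx *m a) = iC R *: (mode_mx *m (diag_mx (\row_j (eps j)%:C) *m a)).
Proof.
move=> hu; rewrite !mode_mx_mul mulmx_sumr scaler_sumr; apply: eq_bigr => j _.
by rewrite -scalemxAr hu !scalerA mul_diag_mx !mxE; congr (_ *: _); ring.
Qed.

Variables (m : nat) (hm : (m <= 2 * n)%N) (h : 'M[R]_(2 * n)).
Variables (g : {ffun 'I_m -> bool} -> C) (eps : 'I_n -> R).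
Hypothesis h_antisym : trmx h = - h.
Hypothesis Himp_herm : is_hermitian (Himp hm g).
Hypothesis u_ortho : forall j k, (adj (u j) *m u k) 0 0 = (j == k)%:R.
Hypothesis u_eigen : forall j, cplx h *m u j = (iC R * (eps j)%:C) *: u j.
Hypothesis u_anti :
  forall j k, mode_op (u j) * mode_op (u k) + mode_op (u k) * mode_op (u j) = 0.

Let H := H0 h + Himp hm g.
Let E := diag_mx (\row_j (eps j)%:C).
(** Amplitudes of the modes on the impurity Majoranas: [U a = 0] says that the combination [a] does
    not touch the impurity. *)
Let U : 'M[C]_(m, n) := \matrix_(p, j) u j (widen_ord hm p) 0.

Lemma impurity_commutator (a : 'cV[C]_n) : U *m a = 0 ->
  H *m mode_op (mode_mx *m a) =
  mode_op (mode_mx *m a) *m H - mode_op (mode_mx *m (E *m a)).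
Proof.
move=> Ua; change (H * mode_op (mode_mx *m a) =
  mode_op (mode_mx *m a) * H - mode_op (mode_mx *m (E *m a))).
have comm : Himp hm g * mode_op (mode_mx *m a) = mode_op (mode_mx *m a) * Himp hm g.
  apply: Himp_mode_op => p; transitivity ((U *m a) p 0); last by rewrite Ua mxE.
  by rewrite !mxE; apply: eq_bigr => j _; rewrite !mxE.
have := H0_mode_op (mode_mx *m a) h_antisym.
rewrite (mode_mx_eigen _ u_eigen) mode_opZ scalerA iC_sqr scaleN1r => e.
rewrite /H mulrDl mulrDr comm addrAC; congr (_ + _).
by rewrite -e addrC subrK.
Qed.

(** Zero modes away from the impurity commute with [H] and anticommute with each other, so some
    vector of lowest energy is killed by all of them. *)
Lemma ground_state_exists : exists psi (e : R),
  [/\ normalized_ground_state H psi, normsq psi = 1, H *m psi = e%:C *: psi,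
      forall w : 'cV[C]_(Fdim n), e%:C * normsq w <= dot w (H *m w)
    & forall a : 'cV[C]_n, E *m a = 0 -> U *m a = 0 -> excitation psi *m a = 0].
Proof.
have Hh : is_hermitian H by rewrite /is_hermitian /H adjD H0_hermitian ?Himp_herm.
have [e [v [v0 Hv e_min]]] := @hermitian_min_eigenvalue R (2 ^ n).-1 H Hh.
(* The transposed rows of [K] span, possibly redundantly, the common kernel of [E] and [U]. *)
pose K := kermx (col_mx E U)^T.
have zero_mode i : E *m (row i K)^T = 0 /\ U *m (row i K)^T = 0.
  have : col_mx E U *m (row i K)^T = 0.
    apply: trmx_inj; rewrite trmx_mul trmxK trmx0 -row_mul mulmx_ker.
    by apply/rowP => k; rewrite !mxE.
  by rewrite mul_col_mx => /eqP; rewrite col_mx_eq0 => /andP[/eqP ? /eqP ?].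
pose B i := mode_op (mode_mx *m (row i K)^T).
have [||w [w0 Hw Bw]] := @common_kernel_eigenvector _ _ H e%:C
  [seq B i | i <- enum 'I_n] v _ _ v0 Hv.
- move=> _ /mapP[i _ ->]; have [Ei Ui] := zero_mode i.
  by rewrite impurity_commutator // Ei mulmx0 mode_op0 subr0.
- move=> _ _ /mapP[i _ ->] /mapP[k _ ->]; rewrite -2![_ *m _]/(_ * _).
  rewrite [LHS]mode_op_car trmx_mul -mulmxA (mulmxA mode_mx^T) mode_mx_isotropic //.
  by rewrite mul0mx mulmx0 mxE mul0rn raddf0.
have [c nc gs] := normalized_ground_stateP w0 Hw e_min.
exists (c *: w), e; split=> //; first by rewrite -scalemxAr Hw !scalerA mulrC.
move=> a Ea Ua; have /submxP[x ax] : (a^T <= K)%MS.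
  by apply/sub_kermxP; rewrite -trmx_mul mul_col_mx Ea Ua col_mx0 trmx0.
have -> : a = \sum_i x 0 i *: (row i K)^T.
  apply: trmx_inj; rewrite ax raddf_sum [LHS]mulmx_sum_row.
  by apply: eq_bigr => i _; apply/rowP => k; rewrite !mxE.
rewrite mulmx_sumr big1 // => i _.
rewrite -scalemxAr excitation_mul -scalemxAr Bw ?scaler0 //.
by apply: map_f; rewrite mem_enum.
Qed.

Lemma normsq_excitation_le psi (a : 'cV[C]_n) : normsq psi = 1 ->
  normsq (excitation psi *m a) <= 2 * normsq a.
Proof.
move=> npsi; rewrite excitation_mul (le_trans (normsq_mode_op_le _ _)) // npsi mulr1.
by rewrite normsq_isometry // mode_mx_isometry.
Qed.

(** The iteration is run with [A = H - e]: as [psi] has energy [e], the commutator relation applied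
    to [psi] becomes [X E a = - A X a]. *)
Lemma correlation_decay psi (e omega : R) (N s : nat) :
  normsq psi = 1 -> H *m psi = e%:C *: psi ->
  (forall w : 'cV[C]_(Fdim n), e%:C * normsq w <= dot w (H *m w)) ->
  (forall a : 'cV[C]_n, E *m a = 0 -> U *m a = 0 -> excitation psi *m a = 0) ->
  (forall j, 0 <= eps j) -> (0 < N)%N -> 2^-1 ^+ N <= omega ->
  (forall j, eps j = 0 \/ (omega <= eps j /\ eps j <= 1)) ->
  exists M : 'M[C]_(m + s * N * m, n), forall a : 'cV[C]_n, M *m a = 0 ->
    normsq (excitation psi *m a) <= (2 * 9^-1 ^+ s)%:C * normsq a.
Proof.
move=> npsi Hpsi e_min XZ eps0 N0 Nomega gap; rewrite -(size_shifts R N s).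
have Hh : is_hermitian H by rewrite /is_hermitian /H adjD H0_hermitian ?Himp_herm.
apply: (@adi_decay _ _ _ _ (H - e%:C%:M) _ U eps) => //.
- by rewrite /is_hermitian adjB adj_scalar conj_realC Hh.
- move=> w; rewrite mulmxBl mul_scalar_mx -scaleN1r dotDr !dotZr mulN1r subr_ge0.
  exact: e_min.
- move=> a Ua; rewrite !excitation_mul mulmxBl (mulmxA H) impurity_commutator //.
  rewrite mulmxBl -mulmxA Hpsi mul_scalar_mx -scalemxAr -/E.
  by rewrite addrAC subrr add0r opprK.
- by move=> a; apply: normsq_excitation_le.
- exact: shifts_gt0.
- by rewrite exprn_ge0 // invr_ge0.
move=> j ej; have [e0|[oe e1]] := gap j; first by rewrite e0 eqxx in ej.
by apply: shifts_ratio => //; rewrite e1 (le_trans Nomega).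
Qed.

End Correlations.

(** * Choice of the number of repetitions and the final estimate *)

Theorem theorem2 (R : realType) :
  exists c : R, 0 < c /\
  forall (n m : nat) (hm1 : (1 <= m)%N) (hm : (m <= 2 * n)%N)
    (h : 'M[R]_(2 * n))
    (g : {ffun 'I_m -> bool} -> R[i])
    (u : 'I_n -> 'cV[R[i]]_(2 * n)) (eps : 'I_n -> R) (omega : R),
    (* h real antisymmetric with operator norm at most 1 *)
    trmx h = - h ->
    (forall v : 'cV[R]_(2 * n), (trmx (h *m v) *m (h *m v)) 0 0 <= (trmx v *m v) 0 0) ->
    (* H_imp Hermitian *)
    is_hermitian (Himp hm g) ->
    (* canonical modes b_j = sum_p (u_j)_p c_p of H_0 *)
    (forall j k : 'I_n, (adj (u j) *m u k) 0 0 = (j == k)%:R) ->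
    (forall j : 'I_n, cplx h *m u j = (iC R * (eps j)%:C) *: u j) ->
    (forall j : 'I_n, 0 <= eps j) ->
    (forall j k : 'I_n, mode_op (u j) * mode_op (u k) + mode_op (u k) * mode_op (u j) = 0) ->
    (* spectral gap hypothesis *)
    0 < omega -> omega <= 1 ->
    (forall j : 'I_n, eps j = 0 \/ (omega <= eps j /\ eps j <= 1)) ->
    exists psi : 'cV[R[i]]_(Fdim n),
      normalized_ground_state (H0 h + Himp hm g) psi /\
      forall sigma : 'I_n -> R,
        (forall j k : 'I_n, (j <= k)%N -> sigma k <= sigma j) ->
        spectrum (\matrix_(j, k) expect psi (adj (mode_op (u j)) * mode_op (u k)))
                 [seq (sigma j)%:C | j <- enum 'I_n] ->
        forall j : 'I_n,
          sigma j <= c * expR (- (j.+1)%:R / (14 * m%:R * ln (2 / omega))).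
Proof.
(* The 2 is the norm bound for the modes; [expR 2] pays for rounding the number of repetitions. *)
exists (2 * expR 2); split; first by rewrite mulr_gt0 ?expR_gt0.
move=> n m m0 hm h g u eps omega h_antisym _ himp ortho eigen eps0 anti w0 w1 gap.
have [psi [e [gs npsi Hpsi e_min XZ]]] :=
  ground_state_exists h_antisym himp eigen anti.
exists psi; split=> // sigma sigma_mono; rewrite -excitation_gram => spec j.
have [N [N0 Nomega NL]] := dyadic_depth w0 w1.
(* Below [m] even the zero-mode conditions do not fit, and the bound 2 with no condition
   suffices. *)
have [jm|mj] := ltnP j m.
  have j_le : (j.+1 <= m + 1 * N * m)%N by lia.
  apply: le_trans (decay_numerics m0 N0 NL j_le).
  rewrite mulr1; apply: (minimax_bound (M := 0 : 'M_(0, n)) sigma_mono spec) => // a _.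
  by rewrite realC2 normsq_excitation_le.
have Nm0 : (0 < N * m)%N by rewrite muln_gt0 N0.
(* The largest [s] whose codimension fits into the zero-based index [j]; maximality bounds the
   one-based index [j.+1]. *)
pose s := ((j - m) %/ (N * m))%N.
have s_le : (m + s * N * m <= j)%N.
  by have := leq_divM (j - m) (N * m); rewrite -/s mulnA; lia.
have s_gt : (j.+1 <= m + s.+1 * N * m)%N.
  by have := ltn_ceil (j - m) Nm0; rewrite -/s mulnA; lia.
apply: le_trans (decay_numerics m0 N0 NL s_gt).
have [M hM] := correlation_decay h_antisym himp ortho eigen s npsi Hpsi e_min XZ
  eps0 N0 Nomega gap.
exact: minimax_bound sigma_mono spec s_le hM.
Qed.
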